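(* Let $a\ge2$ be an integer. Then $$\bigcup_{b\ge a}R_{(a,b)}=\{1,\ldots,a-1\},$$ where the union is taken over all integers $b$ with $b\ge a$.
   Context: $K$ is a field. For integers $a,b\ge2$, let $R_{(a,b)}$ be the set of all reduction numbers $r(I)$ of ideals $I=(x^a,y^b,x^cy^d)\subset K[x,y]$, where $c,d$ are integers with $0<c<a$, $0<d<b$ and $bc+ad\ge ab$. Here, with $J=(x^a,y^b)$, the reduction number $r(I)$ is the smallest integer $r\ge0$ with $I^{r+1}=JI^r$ (such $r$ exists). *)

(* Defs.v *)
From mathcomp Require Import all_boot all_algebra.
From mathcomp Require Import classical_sets.
From mathcomp Require Import mpoly.
Set Implicit Arguments.
Unset Strict Implicit.
Unset Printing Implicit Defensive.
Import GRing.Theory.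
Local Open Scope ring_scope.
Local Open Scope classical_set_scope.

(* Ideals are [set]s of ring elements, so that equality of ideals is [=];
   ring_quotient's [idealr] covers only proper ideals given by boolean
   predicates, and has no generated ideals, products or powers. *)
Definition ideal_span (R : comNzRingType) (S : set R) : set R :=
  [set f | exists (n : nat) (u g : 'I_n -> R),
     (forall i, S (g i)) /\ f = \sum_(i < n) u i * g i].

Definition ideal_mul (R : comNzRingType) (I J : set R) : set R :=
  ideal_span [set f * g | f in I & g in J].

Definition ideal_exp (R : comNzRingType) (I : set R) (n : nat) : set R :=
  iter n (ideal_mul I) setT.

Definition is_reduction_number (R : comNzRingType) (J I : set R) (r : nat) :
    Prop :=
  ideal_exp I r.+1 = ideal_mul J (ideal_exp I r) /\
  forall s : nat,
    ideal_exp I s.+1 = ideal_mul J (ideal_exp I s) -> (r <= s)%N.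

(* K[x, y] with x = 'X_ord0 and y = 'X_ord_max. *)
Definition idealJ (K : fieldType) (a b : nat) : set {mpoly K[2]} :=
  ideal_span [set 'X_ord0 ^+ a; 'X_ord_max ^+ b].
Arguments idealJ : clear implicits.

Definition idealI (K : fieldType) (a b c d : nat) : set {mpoly K[2]} :=
  ideal_span [set 'X_ord0 ^+ a; 'X_ord_max ^+ b;
                  'X_ord0 ^+ c * 'X_ord_max ^+ d].
Arguments idealI : clear implicits.

Definition reduction_numbers (K : fieldType) (a b : nat) : set nat :=
  [set r : nat | exists c d : nat,
     [/\ (0 < c < a)%N, (0 < d < b)%N, (a * b <= b * c + a * d)%N &
         is_reduction_number (idealJ K a b) (idealI K a b c d) r]].

(* Main.v *)
Require Import Defs.
From mathcomp Require Import all_boot all_algebra.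
From mathcomp Require Import classical_sets.
From mathcomp Require Import mpoly zify.
Import GRing.Theory.
Local Open Scope classical_set_scope.

(** Write m = x^c y^d. The ideals I^(r+1) and J I^r are generated by products
    (x^a)^i (y^b)^j m^k with i + j + k = r + 1, the second one without
    m^(r+1). Hence I^(r+1) = J I^r exactly when m^(r+1) lies in J I^r
    ([reduction_stepE]). Since these generators are monomials, membership means
    divisibility by one of them ([monomial_mem_span]), so the condition is
    arithmetic ([idealI_reduction_stepE]): there are i + j + k = r + 1 with
    k <= r such that a i <= c (i + j) and b j <= d (i + j).

    Setting s = i + j and e = a - c, such i and j exist exactly when some
    fraction of denominator s lies in the interval [e/a, d/b]. Thus r(I) + 1 is
    the least denominator of a fraction in that interval, which is nonempty
    because bc + ad >= ab. This denominator is at most a, because of e/a, and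
    it is at least 2, because 0 < e/a and d/b < 1. Conversely, the least
    denominator in [1/a, 1/n] is n whenever 2 <= n <= a; the interval is
    obtained from c = a - 1, d = a, b = n a, which gives every value
    r = n - 1 between 1 and a - 1. *)

(** * Generated ideals and their products *)

Section IdealSpan.
Local Open Scope ring_scope.
Variable R : comNzRingType.
Implicit Types (S T : set R) (f g u : R).

Lemma ideal_span0 S : ideal_span S 0.
Proof. by exists 0%N, (fun=> 0), (fun=> 0); split=> [[]//|]; rewrite big_ord0. Qed.

Lemma ideal_spanD S f g : ideal_span S f -> ideal_span S g -> ideal_span S (f + g).
Proof.
move=> [n [u [h [Sh ->]]]] [p [v [k [Sk ->]]]].
pose join (w : 'I_n -> R) (w' : 'I_p -> R) i :=
  match split i with inl i => w i | inr i => w' i end.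
exists (n + p)%N, (join u v), (join h k); split.
  by move=> i; rewrite /join; case: (split i).
rewrite big_split_ord /=; congr (_ + _); apply: eq_bigr => i _.
  by rewrite /join (unsplitK (inl i : 'I_n + 'I_p)%type).
by rewrite /join (unsplitK (inr i : 'I_n + 'I_p)%type).
Qed.

Lemma ideal_spanM S u f : ideal_span S f -> ideal_span S (u * f).
Proof.
move=> [n [v [g [Sg ->]]]]; exists n, (fun i => u * v i), g; split=> //.
by rewrite mulr_sumr; apply: eq_bigr => i _; rewrite mulrA.
Qed.

Lemma sub_ideal_span S : S `<=` ideal_span S.
Proof.
move=> f Sf; exists 1%N, (fun=> 1), (fun=> f); split=> //.
by rewrite big_ord1 mul1r.
Qed.

Lemma ideal_span_sum S (n : nat) (F : 'I_n -> R) :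
  (forall i, ideal_span S (F i)) -> ideal_span S (\sum_(i < n) F i).
Proof.
move=> SF; elim/big_ind: _ => //; first exact: ideal_span0.
exact: ideal_spanD.
Qed.

Lemma ideal_span_min S T : S `<=` ideal_span T -> ideal_span S `<=` ideal_span T.
Proof.
move=> ST f [n [u [g [Sg ->]]]]; apply: ideal_span_sum => i.
by apply/ideal_spanM/ST/Sg.
Qed.

Lemma ideal_mul_span S T :
  ideal_mul (ideal_span S) (ideal_span T) =
  ideal_span [set f * g | f in S & g in T].
Proof.
apply/seteqP; split; apply: ideal_span_min; last first.
  move=> _ [f Sf [g Tg <-]]; apply: sub_ideal_span.
  by exists f; [exact: sub_ideal_span | exists g; [exact: sub_ideal_span|]].
move=> _ [_ [n [u [f [Sf ->]]]] [_ [p [v [g [Tg ->]]]] <-]].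
rewrite big_distrlr /=; apply: ideal_span_sum => i; apply: ideal_span_sum => j.
rewrite mulrACA; apply: ideal_spanM; apply: sub_ideal_span.
by exists (f i) => //; exists (g j).
Qed.

(** * Powers of an ideal with three generators *)

Section ThreeGenerators.
Variables x y z : R.

(** Capping the exponent of [z] lets the same sets generate both
    (x, y, z)^n, with m = n, and (x, y) (x, y, z)^(n - 1), with m = n - 1. *)
Definition power_products (n m : nat) : set R :=
  [set f | exists i j k : nat,
     [/\ (i + j + k = n)%N, (k <= m)%N & f = x ^+ i * y ^+ j * z ^+ k]].

Lemma mul_span_power_products n :
  ideal_mul (ideal_span [set x; y]) (ideal_span (power_products n n)) =
  ideal_span (power_products n.+1 n).
Proof.
rewrite ideal_mul_span; congr ideal_span; apply/seteqP; split=> f.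
  move=> [_ [] -> [_ [i [j [k [ijk kn ->]]]] <-]].
    by exists i.+1, j, k; split=> //; [lia | rewrite exprS !mulrA].
  by exists i, j.+1, k; split=> //; [lia | rewrite exprS !mulrA [y * _]mulrC].
move=> [[|i] [j [k [ijk kn ->]]]].
  case: j ijk => [|j] ijk; first by lia.
  exists y; first by right.
  exists (x ^+ 0 * y ^+ j * z ^+ k); first by exists 0%N, j, k; split=> //; lia.
  by rewrite exprS !mul1r mulrA.
exists x; first by left.
exists (x ^+ i * y ^+ j * z ^+ k); first by exists i, j, k; split=> //; lia.
by rewrite exprS !mulrA.
Qed.

Lemma ideal_exp_span n :
  ideal_exp (ideal_span [set x; y; z]) n = ideal_span (power_products n n).
Proof.
elim: n => [|n IHn].
  apply/seteqP; split=> // f _; rewrite -[f]mulr1; apply: ideal_spanM.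
  by apply: sub_ideal_span; exists 0%N, 0%N, 0%N; rewrite !mulr1.
rewrite /ideal_exp iterS -/(ideal_exp _ n) IHn ideal_mul_span.
congr ideal_span; apply/seteqP; split=> f.
  move=> [_ [[]|] -> [_ [i [j [k [ijk kn ->]]]] <-]].
  - by exists i.+1, j, k; split=> //; [lia | lia | rewrite exprS !mulrA].
  - exists i, j.+1, k; split=> //; [lia | lia | ].
    by rewrite exprS !mulrA [y * _]mulrC.
  by exists i, j, k.+1; split=> //; [lia | rewrite exprS mulrCA].
move=> [i [j [[|k] [ijk kn ->]]]]; last first.
  exists z; first by right.
  exists (x ^+ i * y ^+ j * z ^+ k); first by exists i, j, k; split=> //; lia.
  by rewrite exprS mulrCA.
case: i ijk => [|i] ijk.
  case: j ijk => [|j] ijk; first by lia.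
  exists y; first by left; right.
  exists (x ^+ 0 * y ^+ j * z ^+ 0); first by exists 0%N, j, 0%N; split=> //; lia.
  by rewrite exprS !mul1r mulrA.
exists x; first by left; left.
exists (x ^+ i * y ^+ j * z ^+ 0); first by exists i, j, 0%N; split=> //; lia.
by rewrite exprS !mulrA.
Qed.

(** The only generator of the left-hand ideal that the right-hand ideal may
    miss is [z ^+ r.+1]. *)
Lemma reduction_stepE r :
  ideal_exp (ideal_span [set x; y; z]) r.+1 =
    ideal_mul (ideal_span [set x; y]) (ideal_exp (ideal_span [set x; y; z]) r)
  <-> ideal_span (power_products r.+1 r) (z ^+ r.+1).
Proof.
rewrite !ideal_exp_span mul_span_power_products; split=> [<-|zJ].
  by apply: sub_ideal_span; exists 0%N, 0%N, r.+1; rewrite !mul1r.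
apply/seteqP; split; apply: ideal_span_min => f [i [j [k [ijk kr ->]]]].
  have [kr'|kr'] := leqP k r; first by apply: sub_ideal_span; exists i, j, k.
  have [-> -> ->] : [/\ i = 0%N, j = 0%N & k = r.+1] by split; lia.
  by rewrite !mul1r.
by apply: sub_ideal_span; exists i, j, k; split=> //; lia.
Qed.

End ThreeGenerators.
End IdealSpan.

(** * Monomial ideals *)

Section Monomials.
Local Open Scope ring_scope.

(** In a representation of ['X_[m]] as a combination of the generators, the
    monomial [m] must occur in some term, hence be a multiple of the
    generator of that term. *)
Lemma monomial_mem_span (R : comNzRingType) (n : nat) (M : set 'X_{1..n})
    (m : 'X_{1..n}) :
  ideal_span [set 'X_[R, p] | p in M] 'X_[m] <->
  exists2 p, M p & (forall i, p i <= m i)%N.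
Proof.
split=> [[t [u [g [Mg Xm]]]]|[p Mp /mnm_lepP pm]]; last first.
  rewrite -(submK pm) mpolyXD; apply/ideal_spanM/sub_ideal_span.
  by exists p.
have [/existsP [i mi]|no] := boolP [exists i, m \in msupp (u i * g i)].
  have [p Mp gE] := Mg i; exists p => // j.
  move: mi; rewrite -gE (perm_mem (msuppMX _ _)) => /mapP [q _ ->].
  by rewrite mnmDE leq_addr.
have : 'X_[R, m]@_m = 0.
  rewrite Xm raddf_sum big1 //= => i _; apply/eqP; rewrite mcoeff_eq0.
  by apply: contra no => mi; apply/existsP; exists i.
by rewrite mcoeffX eqxx => /eqP; rewrite oner_eq0.
Qed.

Definition mnm2 (i j : nat) : 'X_{1..2} := [multinom if k == ord0 then i else j | k < 2].

Lemma mpolyX_mnm2 (R : comNzRingType) (i j : nat) :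
  'X_[R, mnm2 i j] = 'X_ord0 ^+ i * 'X_ord_max ^+ j.
Proof.
rewrite mpolyXE_id big_ord_recl big_ord1 !mnmE /=.
by congr (_ * 'X_ _ ^+ _); apply: val_inj.
Qed.

End Monomials.

(** A generator (x^a)^i (y^b)^j m^k divides m^(r+1) = m^(i + j + k) exactly
    when (x^a)^i (y^b)^j divides m^(i + j): the factor m^k cancels. *)
Lemma idealI_reduction_stepE (K : fieldType) (a b c d r : nat) :
  ideal_exp (idealI K a b c d) r.+1 =
    ideal_mul (idealJ K a b) (ideal_exp (idealI K a b c d) r) <->
  exists i j k : nat, [/\ i + j + k = r.+1, k <= r,
    a * i <= c * (i + j) & b * j <= d * (i + j)].
Proof.
rewrite /idealI /idealJ reduction_stepE.
have genE i j k : (('X_ord0 ^+ a) ^+ i * ('X_ord_max ^+ b) ^+ j *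
    ('X_ord0 ^+ c * 'X_ord_max ^+ d) ^+ k =
    'X_[K, mnm2 (a * i + c * k) (b * j + d * k)] :> {mpoly K[2]})%R.
  by rewrite mpolyX_mnm2 exprMn -!exprM mulrACA -!exprD.
have -> : power_products _ ('X_ord0 ^+ a)%R ('X_ord_max ^+ b)%R
      ('X_ord0 ^+ c * 'X_ord_max ^+ d)%R r.+1 r =
    [set 'X_[K, p]%R | p in [set p | exists i j k : nat,
      [/\ i + j + k = r.+1, k <= r & p = mnm2 (a * i + c * k) (b * j + d * k)]]].
  apply/seteqP; split=> f.
    move=> [i [j [k [ijk kr ->]]]].
    by exists (mnm2 (a * i + c * k) (b * j + d * k)); [exists i, j, k|].
  by move=> [_ [i [j [k [ijk kr ->]]]] <-]; exists i, j, k.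
have -> : (('X_ord0 ^+ c * 'X_ord_max ^+ d) ^+ r.+1 =
    'X_[K, mnm2 (c * r.+1) (d * r.+1)] :> {mpoly K[2]})%R.
  by rewrite mpolyX_mnm2 exprMn -!exprM.
rewrite monomial_mem_span; split.
  move=> [_ [i [j [k [ijk kr ->]]]] le_exp]; exists i, j, k.
  have := le_exp ord0; have := le_exp ord_max; rewrite !mnmE /= -ijk !mulnDr.
  by rewrite !leq_add2r.
move=> [i [j [k [ijk kr lex ley]]]].
exists (mnm2 (a * i + c * k) (b * j + d * k)); first by exists i, j, k.
move=> l; rewrite !mnmE -ijk !(mulnDr _ (i + j) k).
by case: ifP => _; rewrite leq_add2r.
Qed.

(** * The range of the reduction numbers *)

Lemma reduction_number_bounds (K : fieldType) (a b c d r : nat) :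
  0 < c < a -> 0 < d < b -> a * b <= b * c + a * d ->
  is_reduction_number (idealJ K a b) (idealI K a b c d) r -> 1 <= r <= a - 1.
Proof.
move=> /andP[c0 ca] /andP[d0 db] abcd [step minr]; apply/andP; split.
  case: r step {minr} => // /idealI_reduction_stepE [i [j [k [ijk k0 ai bj]]]].
  (* The interval lies strictly between 0 and 1, so it contains no fraction
     of denominator 1. *)
  have ij1 : i + j = 1 by lia.
  move: ai bj; rewrite ij1 !muln1.
  by case: i ij1 {ijk} => [|i]; case: j => [|j]; nia.
apply: minr; apply/idealI_reduction_stepE.
(* The fraction (a - c)/a is at the left end of the interval. *)
by exists c, (a - c), 0; split; nia.
Qed.

Lemma reduction_number_realized (K : fieldType) (a r : nat) :
  1 <= r <= a - 1 ->
  is_reduction_number (idealJ K a (r.+1 * a)) (idealI K a (r.+1 * a) a.-1 a) r.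
Proof.
case: a => [|a]; first by lia.
move=> /andP[r1 ra]; split.
  (* The fraction 1/(r + 1) is at the right end of the interval. *)
  by apply/idealI_reduction_stepE; exists r, 1, 0; split=> /=; nia.
move=> s /idealI_reduction_stepE [i [j [k [ijk ks ai bj]]]].
(* The fraction j/(i + j) lies in [1/a, 1/(r + 1)], so that j > 0 and
   i + j >= (r + 1) j >= r + 1. *)
have j0 : 0 < j by case: j ijk ai bj => // ijk; rewrite /= addn0; nia.
have : r.+1 * j <= i + j by rewrite -(leq_pmul2l (ltn0Sn a)) mulnA [a.+1 * _]mulnC.
by nia.
Qed.

Theorem proposition4p6 (K : fieldType) (a : nat) (ha : (2 <= a)%N) :
  \bigcup_(b in [set b : nat | (a <= b)%N]) reduction_numbers K a b =
  [set r : nat | (1 <= r <= a - 1)%N].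
Proof.
apply/seteqP; split=> r.
  by move=> [b _ [c [d [hc hd abcd]]]]; exact: reduction_number_bounds.
move=> /= hr; exists (r.+1 * a) => /=; first by rewrite leq_pmull.
exists a.-1, a; split; [lia | nia | nia | exact: reduction_number_realized].
Qed.
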